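(* (1) For every extremal polynomial monotone $P_E$ (defined in the context), $P_E$ is a convex function on the density matrices of any finite-dimensional Hilbert space, i.e. $-P_E$ is concave, and consequently $\rho\succ\sigma$ implies $P_E(\rho)\ge P_E(\sigma)$. (2) Let $F$ be a real polynomial such that $F'(y)+F''(y)\ge 0$ for all $y\le 0$ (equivalently, such that $f(x)=xF(\ln x)$ is convex on $(0,1]$), and put $P(\rho)=\mathrm{Tr}[\rho F(\ln\rho)]$. Then, up to an additive constant, $P$ is a finite linear combination of extremal polynomial monotones with non-negative coefficients.
   Context: For a real polynomial $F$ and a density matrix $\rho$ with eigenvalues $\lambda_i$, $\mathrm{Tr}[\rho F(\ln\rho)]=\sum_i\lambda_iF(\ln\lambda_i)$, with zero eigenvalues contributing $0$. Extremal polynomial monotones: let $G$ be a polynomial of the form $G(y)=\prod_{i=1}^d(y+a_i)^2$ or $G(y)=-y\prod_{i=1}^d(y+a_i)^2$ with integer $d\ge 0$ (empty product $=1$) and all $a_i\ge 0$. Let $F$ be the unique polynomial with $F''(y)+F'(y)=G(y)$ and $F(0)=0$. The associated extremal polynomial monotone is $P_E(\rho)=\mathrm{Tr}[\rho F(\ln\rho)]$; it is denoted $P_E^{(n)}$ when $\deg F=n$, i.e. $\deg G=n-1$. Majorization: for density matrices $\rho_1,\rho_2$ of the same dimension $d$ with eigenvalues in decreasing order $\lambda_1\ge\dots\ge\lambda_d$ and $\kappa_1\ge\dots\ge\kappa_d$, $\rho_1\succ\rho_2$ means $\sum_{k=1}^m\lambda_k\ge\sum_{k=1}^m\kappa_k$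 for all $m=1,\dots,d$. *)

(* Defs.v *)
From mathcomp Require Import all_boot all_order all_algebra.
From mathcomp Require Import sesquilinear spectral complex.
From mathcomp Require Import all_classical all_reals all_analysis.

Set Implicit Arguments.
Unset Strict Implicit.
Unset Printing Implicit Defensive.

Import Order.TTheory GRing.Theory Num.Theory.

Local Open Scope ring_scope.
Local Open Scope sesquilinear_scope.
Local Open Scope complex_scope.

(* In the order of R[i], [0 <= z] means that z is real and non-negative. *)
Definition is_density (R : realType) (n : nat) (rho : 'M[R[i]]_n) : Prop :=
  [/\ rho \is hermsymmx,
      forall v : 'cV[R[i]]_n, 0 <= (v ^t* *m rho *m v) 0 0
    & \tr rho = 1].

(* Eigenvalues with multiplicity, in decreasing order. [spectral_diag] is
   meaningful for normal matrices, and its entries are real for Hermitian ones,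
   so that [complex.Re] loses nothing there. *)
Definition eigenvalues (R : realType) (n : nat) (rho : 'M[R[i]]_n) : seq R :=
  sort >=%R [seq complex.Re (spectral_diag rho 0 i) | i <- enum 'I_n].

(* Tr[rho F(ln rho)]: a zero eigenvalue contributes 0 because of the factor l,
   [ln] being total. *)
Definition trace_F_ln (R : realType) (F : {poly R}) (n : nat)
    (rho : 'M[R[i]]_n) : R :=
  \sum_(l <- eigenvalues rho) l * F.[ln l].

Definition majorizes (R : realType) (n : nat) (rho sigma : 'M[R[i]]_n) : Prop :=
  forall m : nat, (1 <= m <= n)%N ->
    \sum_(l <- take m (eigenvalues sigma)) l
      <= \sum_(l <- take m (eigenvalues rho)) l.

Definition convex_on_densities (R : realType) (n : nat)
    (P : 'M[R[i]]_n -> R) : Prop :=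
  forall (rho sigma : 'M[R[i]]_n) (t : R),
    is_density rho -> is_density sigma -> 0 <= t <= 1 ->
    P (t%:C *: rho + (1 - t)%:C *: sigma) <= t * P rho + (1 - t) * P sigma.

Definition extremal_G (R : realType) (G : {poly R}) : Prop :=
  exists2 a : seq R, all (fun x => 0 <= x) a
    & G = \prod_(x <- a) ('X + x%:P) ^+ 2
      \/ G = - 'X * \prod_(x <- a) ('X + x%:P) ^+ 2.

(* [trace_F_ln F] is an extremal polynomial monotone; the two equations
   determine F from G. *)
Definition extremal_F (R : realType) (F : {poly R}) : Prop :=
  exists2 G : {poly R}, extremal_G G & F^`(2) + F^`() = G /\ F.[0] = 0.

(* Main.v *)
(** The function f(x) = x F(ln x) satisfies f''(e^y) = e^-y (F'(y) + F''(y)), so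
    convexity of f on (0,1] is non-negativity of G = F' + F'' on y <= 0. Then
    (e^y F')' = e^y G >= 0 and e^y F' tends to 0 at -oo, so F' >= 0 there, which
    is what makes the tangents of f valid at the endpoint x = 0 as well.
    Convexity of the trace follows from Jensen's inequality, applied to the
    doubly stochastic weights that give the diagonal of a density matrix in
    an eigenbasis of the convex combination; monotonicity under majorization
    is Karamata's inequality.

    For the decomposition, finite non-negative combinations of the extremal
    polynomials G are closed under products, because (-y)(-y) = (y + 0)^2.
    Hence it suffices to factor a polynomial that is non-negative on y <= 0:
    a real root r >= 0 contributes r + (-y), a root r < 0 is double and
    contributes (y - r)^2, and a non-real root p + iq contributes
    (y - p)^2 + q^2, which for p > 0 is (y + 0)^2 + 2p(-y) + (p^2 + q^2).
    Finally F |-> F'' + F' is bijective modulo constants, and a constant C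
    contributes C Tr rho = C. *)

Require Import Defs.
From mathcomp Require Import all_boot all_order all_algebra.
From mathcomp Require Import sesquilinear spectral complex.
From mathcomp Require Import all_classical all_reals all_analysis.
From mathcomp Require Import ring lra.

Set Implicit Arguments.
Unset Strict Implicit.
Unset Printing Implicit Defensive.

Import Order.TTheory GRing.Theory Num.Theory.
Import numFieldNormedType.Exports.

Local Open Scope ring_scope.

(** * Convexity of x F(ln x) *)

Lemma is_derive_horner (R : realType) (p : {poly R}) (x : R) :
  is_derive x 1 (horner p) (p^`()).[x].
Proof.
apply: DeriveDef; first exact: derivable_horner.
by rewrite derivE derive1E.
Qed.

Lemma is_derive_expR_horner (R : realType) (p : {poly R}) (x : R) :
  is_derive x 1 (fun y => expR y * p.[y]) (expR x * (p + p^`()).[x]).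
Proof.
have dp := is_derive_horner p x.
apply: is_derive_eq => /=.
rewrite /GRing.scale /= hornerD; ring.
Qed.

(** The order of [u] and [v] is left open because a tangent is compared with the function on both
    sides of its point of contact. *)
Lemma MVT_between (R : realType) (f df : R -> R) (u v : R) : u != v ->
  (forall x : R, is_derive x 1 f (df x)) ->
  exists2 c, Num.min u v < c < Num.max u v & f v - f u = df c * (v - u).
Proof.
move=> uv dfE.
have cf a b : {within `[a, b], continuous f}%classic.
  by apply: derivable_within_continuous => x _; case: (dfE x).
have [lt_uv|lt_vu|eq_uv] := ltgtP u v.
- have [c c_in eq_c] := MVT lt_uv (fun x _ => dfE x) (cf u v).
  by exists c.
- have [c c_in eq_c] := MVT lt_vu (fun x _ => dfE x) (cf v u).
  by exists c => //; rewrite -opprB eq_c; ring.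
- by rewrite eq_uv eqxx in uv.
Qed.

(** Taylor's formula for f(x) = x F(ln x) in the variable x = e^v, where f'(e^u) = (F + F')(u). The
    mean value theorem is used twice: for e^y (F(y) - a) with a = (F + F')(u), whose derivative
    vanishes at u, and then for F + F' between u and the point c so obtained. *)
Lemma tangent_remainder (R : realType) (F : {poly R}) (u v : R) : u != v ->
  exists K d, [/\ 0 < K, Num.min u v < d < Num.max u v &
    expR v * F.[v] = expR u * F.[u] + (F + F^`()).[u] * (expR v - expR u)
      + K * (F^`() + F^`(2)).[d]].
Proof.
move=> uv.
pose a := (F + F^`()).[u].
have dh (x : R) : is_derive x 1 (fun y => expR y * (F - a%:P).[y])
    (expR x * ((F + F^`()).[x] - a)).
  have := is_derive_expR_horner (F - a%:P) x; congr (is_derive _ _ _ _).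
  by rewrite derivB derivC subr0 !hornerE; ring.
have [c c_in eq_c] := MVT_between uv dh.
have uc : u != c.
  apply/eqP => uc; move: c_in; rewrite -uc /Num.min /Num.max.
  by case: (ltP u v) => ?; lra.
have [d d_in eq_d] := MVT_between uc (is_derive_horner (F + F^`())).
exists (expR c * ((c - u) * (v - u))), d; split.
- rewrite mulr_gt0 ?expR_gt0//.
  move: c_in; rewrite /Num.min /Num.max; case: (ltP u v) => ? /andP[? ?]; nra.
- move: c_in d_in; rewrite /Num.min /Num.max.
  case: (ltP u v) => ?; case: (ltP u c) => ? /andP[? ?] /andP[? ?];
    by apply/andP; split; lra.
- have {}eq_d : (F + F^`()).[c] - a = (F^`() + F^`(2)).[d] * (c - u).
    by rewrite eq_d derivD.
  move: eq_c; rewrite eq_d !(hornerD, hornerN, hornerC) => eq_c.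
  rewrite -[LHS](subrK (expR v * a)) -mulrBr.
  rewrite -[_ * (_ - _)](subrK (expR u * (F.[u] - a))) eq_c /a !hornerD; ring.
Qed.

Lemma horner_growth (R : realType) (p : {poly R}) :
  exists C n, 0 <= C /\ forall y, `|p.[y]| <= C * (1 + `|y|) ^+ n.
Proof.
elim/poly_ind: p => [|p c [C [n [C0 leC]]]].
  by exists 0, 0%N; split => // y; rewrite horner0 normr0 mul0r.
exists (C + `|c|), n.+1; split=> [|y]; first by rewrite addr_ge0.
have y1 : 1 <= 1 + `|y| by rewrite lerDl.
rewrite !hornerE (le_trans (ler_normD _ _))// mulrDl lerD//.
  by rewrite normrM exprSr mulrA ler_pM// lerDr.
by rewrite ler_peMr// exprn_ege1.
Qed.

Lemma expR_horner_small (R : realType) (p : {poly R}) (e y0 : R) : 0 < e ->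
  exists2 y, y <= y0 & expR y * `|p.[y]| < e.
Proof.
move=> e0; have [C [n [C0 leC]]] := horner_growth p.
(* From e^(1+x) > (1+x)^(n+1) / (n+1)! follows e^-x C (1+x)^n < [D] / (1+x) if C > 0. The choice of
   x below makes this less than e and keeps -x below [y0]. *)
pose D := C * expR 1 * n.+1`!%:R.
have D0 : 0 <= D by rewrite !mulr_ge0 ?expR_ge0.
pose x := `|y0| + D / e.
have x0 : 0 <= x by rewrite addr_ge0// divr_ge0// ltW.
have x1 : 0 < 1 + x by rewrite ltr_wpDr.
exists (- x).
  by rewrite lerNl (le_trans (ler_norm _))// normrN lerDl divr_ge0// ltW.
have le1 : (1 + x) ^+ n.+1 / n.+1`!%:R < expR 1 * expR x.
  by rewrite -expRD (lt_le_trans _ (expR_ge1Dxn n (ltW x1)))// ltrDr.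
have f0 : 0 < n.+1`!%:R :> R by rewrite ltr0n fact_gt0.
apply: le_lt_trans (ler_wpM2l (expR_ge0 _) (leC _)) _; rewrite normrN (ger0_norm x0).
rewrite expRN mulrC ltr_pdivrMr ?expR_gt0//.
rewrite -(ltr_pM2r x1) -mulrA -exprSr.
move: le1; rewrite ltr_pdivrMr// => le1.
apply: (@le_lt_trans _ _ (D * expR x)).
  by rewrite /D; have := ler_wpM2l C0 (ltW le1); congr (_ <= _); ring.
rewrite [ltRHS]mulrAC ltr_pM2r ?expR_gt0//.
have : D = e * (D / e) by field; rewrite gt_eqF.
move=> ->; rewrite ltr_pM2l// /x.
have := normr_ge0 y0; lra.
Qed.

Lemma nonneg_of_nonneg_add_deriv (R : realType) (p : {poly R}) :
  (forall y, y <= 0 -> 0 <= (p + p^`()).[y]) ->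
  forall y, y <= 0 -> 0 <= p.[y].
Proof.
move=> pp y0 y0le0; rewrite leNgt; apply/negP => py0.
have e0 : 0 < - (expR y0 * p.[y0]) by rewrite oppr_gt0 pmulr_rlt0 ?expR_gt0.
(* As e^y p(y) is nondecreasing on y <= 0, a negative value at [y0] bounds it away from 0 on the
   whole left side, against its decay. *)
have [y y_le] := expR_horner_small p y0 e0.
have py : expR y * p.[y] <= expR y0 * p.[y0].
  have [->//|yy0] := eqVneq y y0.
  have [c c_in eq_c] := MVT_between yy0 (is_derive_expR_horner p).
  rewrite -subr_ge0 eq_c; move: c_in.
  rewrite (min_idPl y_le) (max_idPr y_le) => /andP[yc cy0].
  by rewrite !mulr_ge0 ?expR_ge0 ?subr_ge0// pp// (le_trans (ltW cy0)).
have : 0 <= `|p.[y]| + p.[y] by rewrite -lerBlDr sub0r -normrN ler_norm.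
by have := expR_gt0 y; nra.
Qed.

Lemma horner_lt0_near (R : realType) (p : {poly R}) (r : R) : p.[r] < 0 ->
  exists2 e, 0 < e & forall y, r - e <= y <= r + e -> p.[y] < 0.
Proof.
move=> pr; have : (\forall y \near r, p.[y] < 0)%classic.
  have := @continuous_horner R p r (fun z => z < 0); apply.
  exact: lt_nbhsl pr.
move=> /nbhs_ballP[e /= e0 pe]; exists (e / 2); first by rewrite divr_gt0.
move=> y /andP[ry yr]; apply: pe; rewrite /ball /= ltr_norml.
by apply/andP; split; lra.
Qed.

(** By continuity. It serves for the quotient of a polynomial by a factor vanishing at r, whose sign
    is visible only off r. The test point r - e lies to the left of r so as to remain in y <= 0. *)
Lemma horner_ge0_punctured (R : realType) (p : {poly R}) (r : R) : r <= 0 ->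
  (forall y, y <= 0 -> y != r -> 0 <= p.[y]) -> forall y, y <= 0 -> 0 <= p.[y].
Proof.
move=> r0 pp y y0; have [->|/pp->//] := eqVneq y r.
rewrite leNgt; apply/negP => /horner_lt0_near[e e0 /(_ (r - e))].
have /[swap]/[apply] : r - e <= r - e <= r + e by apply/andP; split; lra.
apply/negP; rewrite -leNgt; apply: pp; first by lra.
by rewrite -subr_eq0 addrAC subrr sub0r oppr_eq0 gt_eqF.
Qed.

Lemma deriv_ge0_of_extremal_ge0 (R : realType) (F : {poly R}) :
  (forall y, y <= 0 -> 0 <= (F^`()).[y] + (F^`(2)).[y]) ->
  forall y, y <= 0 -> 0 <= (F^`()).[y].
Proof.
move=> G0; apply: nonneg_of_nonneg_add_deriv => y y0.
by rewrite hornerD G0.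
Qed.

Lemma ln_subgradient (R : realType) (F : {poly R}) :
  (forall y, y <= 0 -> 0 <= (F^`()).[y] + (F^`(2)).[y]) ->
  forall x y, 0 < x <= 1 -> 0 <= y <= 1 ->
  x * F.[ln x] + (F + F^`()).[ln x] * (y - x) <= y * F.[ln y].
Proof.
move=> G0 x y /andP[x0 x1]; rewrite le_eqVlt => /andP[/orP[/eqP<-|y0] y1].
  (* At y = 0 the claim reduces to - x F'(ln x) <= 0. *)
  rewrite mul0r sub0r hornerD mulrN mulrDl opprD addrA [_ * x]mulrC subrr.
  by rewrite sub0r oppr_le0 mulr_ge0 ?(ltW x0)// deriv_ge0_of_extremal_ge0// ln_le0.
have [->|xy] := eqVneq x y; first by rewrite subrr mulr0 addr0.
have uv : ln x != ln y by apply: contra xy => /eqP /ln_inj ->.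
have [K [d [K0 d_in eqy]]] := tangent_remainder F uv.
move: eqy; rewrite !lnK ?posrE// => ->; rewrite lerDl mulr_ge0 ?(ltW K0)//.
rewrite hornerD G0// ltW//; case/andP: d_in => _ /lt_le_trans; apply.
by rewrite ge_max !ln_le0.
Qed.

Lemma jensen_ln (R : realType) (F : {poly R}) (I : finType) (w a : I -> R) :
  (forall y, y <= 0 -> 0 <= (F^`()).[y] + (F^`(2)).[y]) ->
  (forall i, 0 <= w i) -> \sum_i w i = 1 -> (forall i, 0 <= a i <= 1) ->
  (\sum_i w i * a i) * F.[ln (\sum_i w i * a i)]
    <= \sum_i w i * (a i * F.[ln (a i)]).
Proof.
move=> G0 w0 w1 a01; set m := \sum_i w i * a i.
have wa0 i : 0 <= w i * a i by case/andP: (a01 i) => ? _; rewrite mulr_ge0.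
have : 0 <= m by rewrite sumr_ge0.
rewrite le_eqVlt => /orP[/eqP m0|m0].
  (* At mean 0 no tangent is available, but then every product [w i * a i] vanishes. *)
  rewrite -m0 mul0r big1// => i _; rewrite mulrA.
  have /psumr_eq0P -> // : m = 0 by [].
  by rewrite mul0r.
have m1 : m <= 1.
  rewrite -w1 ler_sum// => i _; case/andP: (a01 i) => _ ?.
  by rewrite ler_piMr.
have sub i : m * F.[ln m] + (F + F^`()).[ln m] * (a i - m) <= a i * F.[ln (a i)].
  by apply: ln_subgradient; rewrite ?m0.
(* Averaging the tangent inequalities at the mean cancels their linear terms. *)
apply: (@le_trans _ _
  (\sum_i w i * (m * F.[ln m] + (F + F^`()).[ln m] * (a i - m)))); last first.
  by rewrite ler_sum// => i _; rewrite ler_wpM2l.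
under eq_bigr do rewrite mulrDr.
rewrite big_split/= -mulr_suml w1 mul1r.
under [X in _ + X]eq_bigr do rewrite mulrCA mulrBr.
rewrite -mulr_sumr.
by rewrite sumrB -/m -mulr_suml w1 mul1r subrr mulr0 addr0.
Qed.

Lemma jensen2_ln (R : realType) (F : {poly R}) (t x y : R) :
  (forall y, y <= 0 -> 0 <= (F^`()).[y] + (F^`(2)).[y]) ->
  0 <= t <= 1 -> 0 <= x <= 1 -> 0 <= y <= 1 ->
  (t * x + (1 - t) * y) * F.[ln (t * x + (1 - t) * y)]
    <= t * (x * F.[ln x]) + (1 - t) * (y * F.[ln y]).
Proof.
move=> G0 /andP[t0 t1] x01 y01.
have := @jensen_ln R F bool (fun b => if b then t else 1 - t)
  (fun b => if b then x else y) G0.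
rewrite !big_bool /=; apply=> [[]|  |[]] //; last by rewrite addrC subrK.
by rewrite subr_ge0.
Qed.

Lemma convex_xFlnP (R : realType) (F : {poly R}) :
  (forall y : R, y <= 0 -> 0 <= (F^`()).[y] + (F^`(2)).[y]) <->
  convex_function (`]0, 1]%classic : set R) (fun x : R => x * F.[ln x]).
Proof.
split=> [G0 t x y|cvx y0 y0le0].
  rewrite !inE /= !in_itv /= => /andP[x0 x1] /andP[y0 y1].
  have := @jensen2_ln R F t%:num x y G0.
  by apply; rewrite ?(ltW x0) ?(ltW y0)//; apply/andP.
rewrite -hornerD leNgt; apply/negP => /horner_lt0_near[e e0 Gneg].
(* On [a, y0] the polynomial G = F' + F'' is negative. Expanding f at the midpoint m of e^a and e^y0
   gives two negative remainders, while the linear terms cancel, so convexity fails with weight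
   1/2. *)
pose a := y0 - e.
have ab : a < y0 by rewrite ltrBlDr ltrDl.
have lt_e : expR a < expR y0 by rewrite ltr_expR.
have ea := expR_gt0 a; have eb : expR y0 <= 1 by rewrite expR_le1.
pose m := (expR a + expR y0) / 2.
have m0 : 0 < m by rewrite /m; lra.
have am : a < ln m by rewrite -ltr_expR lnK// /m; lra.
have mb : ln m < y0 by rewrite -ltr_expR lnK// /m; lra.
have [K1 [d1 [K10 d1_in eq1]]] := tangent_remainder F (negbT (gt_eqF am)).
have [K2 [d2 [K20 d2_in eq2]]] := tangent_remainder F (negbT (lt_eqF mb)).
have R1 : K1 * (F^`() + F^`(2)).[d1] < 0.
  rewrite pmulr_rlt0// Gneg//; move: d1_in.
  rewrite (min_idPr (ltW am)) (max_idPl (ltW am)) => /andP[? ?]; rewrite -/a; lra.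
have R2 : K2 * (F^`() + F^`(2)).[d2] < 0.
  rewrite pmulr_rlt0// Gneg//; move: d2_in.
  rewrite (min_idPl (ltW mb)) (max_idPr (ltW mb)) => /andP[? ?]; rewrite -/a; lra.
have mE : 2^-1 * expR a + (1 - 2^-1) * expR y0 = m by rewrite /m; field.
have h0 : (0 : R) <= 2^-1 by rewrite invr_ge0 ler0n.
have h1 : 2^-1 <= (1 : R) by rewrite invf_le1 ?ler1n ?ltr0n.
have := cvx (Itv01 h0 h1) (expR a) (expR y0).
rewrite !inE /= !in_itv /= ea eb expR_gt0 (le_trans (ltW lt_e)) //.
move=> /(_ isT isT); rewrite /conv /= !expRK /GRing.scale /= mE.
rewrite eq1 eq2 lnK ?posrE//.
have : (F + F^`()).[ln m] * (expR a - m) + (F + F^`()).[ln m] * (expR y0 - m) = 0.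
  by rewrite /m; field.
move: R1 R2; move: (_.[d1]) (_.[d2]) (_.[ln m]) => g1 g2 s R1 R2 sE.
rewrite -[X in _ <= X]/(2^-1 * _ + (1 - 2^-1) * _); lra.
Qed.

(** * The cone of extremal polynomials *)

(** Combinations are built one term at a time, so that closure under sums and products and the
    decomposition of F are all inductions on this predicate. *)
Inductive extremal_cone (R : realType) : {poly R} -> Prop :=
| extremal_cone0 : extremal_cone 0
| extremal_coneD c H G : 0 <= c -> extremal_G H -> extremal_cone G ->
    extremal_cone (c *: H + G).

Lemma extremal_G_prod (R : realType) (a : seq R) : all (fun x => 0 <= x) a ->
  extremal_G (\prod_(x <- a) ('X + x%:P) ^+ 2).
Proof. by move=> a0; exists a => //; left. Qed.

Lemma extremal_G_mul (R : realType) (G H : {poly R}) :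
  extremal_G G -> extremal_G H -> extremal_G (G * H).
Proof.
move=> [a a0 Ga] [b b0 Hb].
have ab0 : all (fun x => 0 <= x) (a ++ b) by rewrite all_cat a0.
case: Ga Hb => -> [] ->.
- by exists (a ++ b) => //; left; rewrite big_cat.
- by exists (a ++ b) => //; right; rewrite big_cat /= mulrCA.
- by exists (a ++ b) => //; right; rewrite big_cat /= mulrA.
- exists (0 :: a ++ b); first by rewrite /= lexx.
  by left; rewrite big_cons big_cat /= polyC0 addr0; ring.
Qed.

Lemma extremal_cone_gen (R : realType) (c : R) (G : {poly R}) :
  0 <= c -> extremal_G G -> extremal_cone (c *: G).
Proof.
by move=> c0 eG; rewrite -[c *: G]addr0; apply: extremal_coneD => //; left.
Qed.

Lemma extremal_cone_add (R : realType) (G H : {poly R}) :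
  extremal_cone G -> extremal_cone H -> extremal_cone (G + H).
Proof.
move=> + coneH; elim=> [|c K G' c0 eK _ IH]; first by rewrite add0r.
by rewrite -addrA; apply: extremal_coneD.
Qed.

Lemma extremal_cone_mul (R : realType) (G H : {poly R}) :
  extremal_cone G -> extremal_cone H -> extremal_cone (G * H).
Proof.
move=> + coneH; elim=> [|c K G' c0 eK _ IH]; first by rewrite mul0r; left.
rewrite mulrDl; apply: extremal_cone_add IH.
elim: coneH => [|d L H' d0 eL _ IH]; first by rewrite mulr0; left.
rewrite mulrDr -scalerAl -scalerAr scalerA; apply: extremal_coneD.
- exact: mulr_ge0.
- exact: extremal_G_mul.
- exact: IH.
Qed.

Lemma extremal_coneC (R : realType) (c : R) : 0 <= c -> extremal_cone c%:P.
Proof.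
move=> c0; rewrite -alg_polyC; apply: extremal_cone_gen => //.
by have := @extremal_G_prod R [::] isT; rewrite big_nil.
Qed.

Lemma extremal_cone_NX (R : realType) : extremal_cone (- 'X : {poly R}).
Proof.
rewrite -[- 'X]scale1r; apply: extremal_cone_gen => //.
by exists [::] => //; right; rewrite big_nil mulr1.
Qed.

Lemma extremal_cone_sqr (R : realType) (a : R) : 0 <= a ->
  extremal_cone (('X + a%:P) ^+ 2).
Proof.
move=> a0; rewrite -[_ ^+ 2]scale1r; apply: extremal_cone_gen => //.
have := @extremal_G_prod R [:: a].
by rewrite /= a0 big_seq1; apply.
Qed.

Lemma extremal_cone_quadratic (R : realType) (p q : R) :
  extremal_cone (('X - p%:P) ^+ 2 + (q ^+ 2)%:P).
Proof.
have [p0|p0] := lerP p 0.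
  apply: extremal_cone_add; last exact/extremal_coneC/sqr_ge0.
  by rewrite -polyCN; apply: extremal_cone_sqr; rewrite oppr_ge0.
have -> : ('X - p%:P) ^+ 2 + (q ^+ 2)%:P =
    ('X + 0%:P) ^+ 2 + ((2 * p)%:P * - 'X + (p ^+ 2 + q ^+ 2)%:P).
  by rewrite !(polyCD, polyCM, rmorphXn) /= polyC0; ring.
apply: extremal_cone_add; first exact: extremal_cone_sqr.
apply: extremal_cone_add; last by apply: extremal_coneC; rewrite addr_ge0 ?sqr_ge0.
apply: extremal_cone_mul; last exact: extremal_cone_NX.
by apply: extremal_coneC; rewrite mulr_ge0// ltW.
Qed.

Lemma size_quadratic (R : realType) (p q : R) :
  size (('X - p%:P) ^+ 2 + (q ^+ 2)%:P) = 3%N.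
Proof.
rewrite size_polyDl size_exp_XsubC//.
by rewrite (leq_ltn_trans (size_polyC_leq1 _)).
Qed.

(** The remainder modulo the quadratic is real of degree at most 1 and vanishes at p + iq. Its
    imaginary part there is q times the leading coefficient, so both coefficients vanish. *)
Lemma complex_root_dvdp (R : realType) (G : {poly R}) (p q : R) : q != 0 ->
  root (map_poly (real_complex R) G) (Complex p q) ->
  ('X - p%:P) ^+ 2 + (q ^+ 2)%:P %| G.
Proof.
move=> q0; set Q := _ + _ => rootG.
have sQ : size Q = 3%N by exact: size_quadratic.
have Q0 : Q != 0 by rewrite -size_poly_eq0 sQ.
have rootQ : (map_poly (real_complex R) Q).[Complex p q] = 0.
  rewrite /Q rmorphD rmorphXn rmorphB /= map_polyX !map_polyC /=.
  rewrite !hornerE; apply/eqP; rewrite eq_complex /=.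
  by rewrite !expr2; apply/andP; split; apply/eqP; ring.
set r := G %% Q; have sr : (size r <= 2)%N by rewrite -ltnS -sQ ltn_modp.
have : (map_poly (real_complex R) r).[Complex p q] = 0.
  have := rootG; rewrite {1}(divp_eq G Q) rmorphD rmorphM /root hornerD hornerM.
  by rewrite rootQ mulr0 add0r => /eqP.
rewrite (@horner_coef_wide _ 2); last by rewrite size_map_poly.
rewrite !big_ord_recl big_ord0 !coef_map /= expr0 mulr1 expr1 addr0.
case=> re im; have r1 : r`_1 = 0.
  by move: im => /eqP; rewrite mul0r addr0 add0r mulf_eq0 (negPf q0) orbF => /eqP.
move: re; rewrite r1 !mul0r subr0 addr0 => r0.
rewrite /dvdp -/r; apply/eqP/polyP => -[|[|i]]; rewrite coef0 //.
by rewrite nth_default// (leq_trans sr).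
Qed.

Lemma extremal_cone_of_ge0 (R : realType) (G : {poly R}) :
  (forall y, y <= 0 -> 0 <= G.[y]) -> extremal_cone G.
Proof.
(* Strong induction on the size: each case splits off a factor in the cone and shows that the
   cofactor is still non-negative on y <= 0. *)
have [n] := ubnP (size G); elim: n G => // n IH G; rewrite ltnS => sG G0.
have [sG1|sG1] := leqP (size G) 1.
  have := G0 0 (lexx _); rewrite (size1_polyC sG1) hornerC.
  exact: extremal_coneC.
have : size (map_poly (real_complex R) G) != 1%N by rewrite size_map_poly gtn_eqF.
have nz0 : G != 0 by rewrite -size_poly_gt0 ltnW.
move=> /closed_rootP[[p q]].
have [->|q0 rootG] := eqVneq q 0; last first.
  set Q := ('X - p%:P) ^+ 2 + (q ^+ 2)%:P.
  have dvQ : Q %| G by exact: complex_root_dvdp.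
  rewrite -(divpK dvQ); apply: extremal_cone_mul (extremal_cone_quadratic _ _).
  have Q0 y : 0 < Q.[y].
    by rewrite !hornerE ltr_wpDl ?sqr_ge0// exprn_even_gt0.
  apply: IH => [|y y0].
    rewrite size_divp -?size_poly_eq0 size_quadratic// (leq_trans _ sG)//.
    by rewrite ltn_subrL (ltn_trans _ sG1).
  by rewrite -(pmulr_lge0 _ (Q0 y)) -hornerM divpK// G0.
rewrite complexr0 (fmorph_root (real_complex R)) => rootG.
have /factor_theorem [H eqG] := rootG.
have H0 : H != 0 by apply: contraNneq nz0 => H0; rewrite eqG H0 mul0r.
have sH : (size H < size G)%N by rewrite eqG size_Mmonic ?monicXsubC// size_XsubC addn2.
have GE y : G.[y] = H.[y] * (y - p) by rewrite eqG !hornerE.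
have [p0|p0] := lerP 0 p.
  have -> : G = - H * (p%:P + - 'X) by rewrite eqG; ring.
  apply: extremal_cone_mul; last first.
    exact: extremal_cone_add (extremal_coneC p0) (extremal_cone_NX _).
  apply: IH; first by rewrite size_polyN (leq_trans sH).
  (* For p = 0 the factor p - y vanishes at y = 0, so the sign of [- H] is read off for y < 0
     only. *)
  apply: (@horner_ge0_punctured _ _ 0) => // y y0 yn0.
  have lt_y : y < 0 by rewrite lt_neqAle yn0.
  have yp : y - p < 0 by lra.
  by rewrite hornerN oppr_ge0 -(nmulr_lge0 _ yp) -GE G0.
(* Otherwise G = H (y - p) would change sign at p < 0: it would be negative just left of p if H(p) >
   0, and just right of p if H(p) < 0. *)
have rootH : H.[p] = 0.
  apply/eqP; rewrite eq_le; apply/andP; split; rewrite leNgt; apply/negP.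
    move=> Hp; have [] := @horner_lt0_near _ (- H) p; first by rewrite hornerN oppr_lt0.
    move=> e e0 /(_ (p - e)); rewrite hornerN oppr_lt0 => Hy.
    have {}Hy : 0 < H.[p - e] by apply: Hy; apply/andP; split; lra.
    have pe : p - e <= 0 by lra.
    have := G0 _ pe; rewrite GE pmulr_rge0//; lra.
  move=> /horner_lt0_near[e e0 Hy].
  (* The bound - p keeps p + d in y <= 0. *)
  pose d := Num.min e (- p).
  have d0 : 0 < d by rewrite lt_min e0 oppr_gt0.
  have de : d <= e by rewrite ge_min lexx.
  have dp : d <= - p by rewrite ge_min lexx orbT.
  have {}Hy : H.[p + d] < 0 by apply: Hy; apply/andP; split; lra.
  have pd : p + d <= 0 by lra.
  have := G0 _ pd; rewrite GE addrAC subrr add0r pmulr_lge0//; lra.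
have /factor_theorem [K eqH] : root H p by apply/eqP.
have GK : G = K * ('X + (- p)%:P) ^+ 2 by rewrite eqG eqH polyCN; ring.
rewrite GK; apply: extremal_cone_mul; last first.
  by apply: extremal_cone_sqr; rewrite oppr_ge0 ltW.
have K0 : K != 0 by apply: contraNneq H0 => K0; rewrite eqH K0 mul0r.
apply: IH.
  rewrite (leq_trans _ sG)// (leq_trans _ sH)// eqH.
  by rewrite size_Mmonic ?monicXsubC// size_XsubC addn2/=.
apply: (@horner_ge0_punctured _ _ p); first exact: ltW.
move=> y y0 yp; have := G0 y y0; rewrite GK hornerM horner_exp hornerD hornerX hornerC.
by rewrite pmulr_lge0// exprn_even_gt0//= subr_eq0.
Qed.

(** * The equation F'' + F' = G and the decomposition of F *)

Lemma extremal_ode_solvable (R : realType) (G : {poly R}) :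
  exists F, F^`(2) + F^`() = G /\ F.[0] = 0.
Proof.
have monomial n : exists F : {poly R}, F^`(2) + F^`() = 'X^n /\ F.[0] = 0.
  elim: n => [|n [F [FE F0]]].
    by exists 'X; rewrite hornerX derivX -[_^`(2)]/(_^`()^`()) derivX derivC add0r.
  (* The operator sends y^(n+2) / (n+2) to y^(n+1) + (n+1) y^n; the second term is removed by the
     solution for y^n. *)
  exists (n.+2%:R^-1 *: 'X^(n.+2) - n.+1%:R *: F); split; last first.
    by rewrite hornerD hornerN !hornerZ F0 hornerXn expr0n /= !mulr0 subrr.
  rewrite -[_^`(2)]/(_^`()^`()) !derivB !derivZ !derivXn /= !derivMn !derivXn /=.
  have f0 : n.+2%:R != 0 :> R by rewrite pnatr_eq0.
  rewrite -(scaler_nat n.+2 ('X^n *+ n.+1)) -(scaler_nat n.+2 'X^(n.+1)).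
  rewrite -(scaler_nat n.+1 'X^n) ![n.+2%:R^-1 *: _]scalerA mulVf// !scale1r.
  rewrite addrACA -opprD -scalerDr -[F^`()^`()]/(F^`(2)) FE.
  by rewrite addrAC subrr add0r.
rewrite -[G]coefK poly_def.
apply: (big_ind (fun H => exists F : {poly R}, F^`(2) + F^`() = H /\ F.[0] = 0))
  => [|_ _ [F [<- F0]] [H [<- H0]]|i _].
- by exists 0; rewrite !linear0 addr0 horner0.
- by exists (F + H); rewrite !linearD /= hornerD F0 H0 addr0 addrACA.
- have [F [FE F0]] := monomial i; exists (G`_i *: F).
  by rewrite !linearZ /= -scalerDr FE hornerZ F0 mulr0.
Qed.

(** D' = - D'' has the same size as its own derivative, which forces D' = 0. *)
Lemma extremal_ode_kernel (R : realType) (D : {poly R}) :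
  D^`(2) + D^`() = 0 -> D = (D.[0])%:P.
Proof.
move=> DE; have D1 : D^`() = 0.
  apply/eqP/negPn/negP => /lt_size_deriv; rewrite -[D^`()^`()]/(D^`(2)).
  by rewrite (_ : D^`(2) = - D^`()) ?size_polyN ?ltnn//; apply/eqP; rewrite -addr_eq0 DE.
apply/polyP => -[|i]; rewrite coefC /=; first by rewrite horner_coef0.
have := congr1 (fun p : {poly R} => p`_i) D1.
by rewrite coef_deriv coef0 => /eqP; rewrite mulrn_eq0 => /eqP.
Qed.

Lemma extremal_decomposition (R : realType) (F : {poly R}) :
  (forall y, y <= 0 -> 0 <= (F^`()).[y] + (F^`(2)).[y]) ->
  exists2 s : seq (R * {poly R}),
    {in s, forall x, 0 <= x.1 /\ extremal_F x.2}
    & F = (F.[0])%:P + \sum_(x <- s) x.1 *: x.2.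
Proof.
move=> G0; have : extremal_cone (F^`(2) + F^`()).
  by apply: extremal_cone_of_ge0 => y y0; rewrite addrC hornerD G0.
move EG: (F^`(2) + F^`()) => G coneG {G0}.
elim: coneG F EG => [|c H G' c0 eH _ IH] F FG.
  by exists [::] => //; rewrite big_nil addr0; apply: extremal_ode_kernel.
have [E [EH E0]] := extremal_ode_solvable H.
(* Subtracting [c *: E] removes the term [c *: H] from the right side, and E(0) = 0 leaves the
   constant F(0) unchanged. *)
have [|s s0 sE] := IH (F - c *: E).
  rewrite derivnB derivB derivnZ derivZ addrACA -opprD -scalerDr EH FG.
  by rewrite addrAC subrr add0r.
exists ((c, E) :: s) => [x|].
  by rewrite inE => /predU1P[->|/s0//]; split => //; exists H.
rewrite big_cons /= addrCA.
have F0E : (F - c *: E).[0] = F.[0].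
  by rewrite hornerD hornerN hornerZ E0 mulr0 subr0.
move: sE; rewrite F0E => <-.
by rewrite addrC subrK.
Qed.

(** * Spectra of density matrices *)

Section DensityMatrices.

Local Open Scope sesquilinear_scope.
Local Open Scope complex_scope.

(** Unsorted and indexed by ['I_n], for sums in which the order of the eigenvalues is immaterial. *)
Definition eigval (R : realType) (n : nat) (rho : 'M[R[i]]_n) (i : 'I_n) : R :=
  complex.Re (spectral_diag rho 0 i).

Lemma perm_eigenvalues (R : realType) (n : nat) (rho : 'M[R[i]]_n) :
  perm_eq (eigenvalues rho) [seq eigval rho i | i <- enum 'I_n].
Proof. by rewrite /eigenvalues perm_sort. Qed.

Lemma sum_eigenvalues (R : realType) (n : nat) (rho : 'M[R[i]]_n) (f : R -> R) :
  \sum_(l <- eigenvalues rho) f l = \sum_i f (eigval rho i).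
Proof. by rewrite (perm_big _ (perm_eigenvalues rho)) big_map big_enum. Qed.

Lemma spectral_eigval (R : realType) (n : nat) (rho : 'M[R[i]]_n) (i : 'I_n) :
  rho \is hermsymmx -> spectral_diag rho 0 i = (eigval rho i)%:C.
Proof.
move=> /hermitian_spectral_diag_real /mxOverP /(_ 0 i) d_real.
by rewrite /eigval RRe_real.
Qed.

Lemma spectral_decomposition (R : realType) (n : nat) (rho : 'M[R[i]]_n) :
  rho \is hermsymmx ->
  rho = (spectralmx rho)^t* *m diag_mx (spectral_diag rho) *m spectralmx rho.
Proof.
move=> /hermitian_normalmx /orthomx_spectralP {1}->.
by rewrite invmx_unitary ?spectral_unitarymx.
Qed.

Lemma eigval_diag (R : realType) (n : nat) (rho : 'M[R[i]]_n) (i : 'I_n) :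
  rho \is hermsymmx ->
  (spectralmx rho *m rho *m (spectralmx rho)^t*) i i = (eigval rho i)%:C.
Proof.
move=> herm; rewrite {2}(spectral_decomposition herm) !mulmxA.
have U := spectral_unitarymx rho.
rewrite (unitarymxP U) mul1mx -mulmxA (unitarymxP U) mulmx1 mxE eqxx.
by rewrite mulr1n spectral_eigval.
Qed.

Lemma eigval_ge0 (R : realType) (n : nat) (rho : 'M[R[i]]_n) (i : 'I_n) :
  is_density rho -> 0 <= eigval rho i.
Proof.
case=> herm psd _; rewrite -ler0c -eigval_diag//.
(* This vector is the eigenvector belonging to the i-th eigenvalue. *)
have := psd ((row i (spectralmx rho))^t*).
rewrite trmxCK -row_mul !mxE; congr (0 <= _).
by apply: eq_bigr => j _; rewrite !mxE.
Qed.

Lemma sum_eigval (R : realType) (n : nat) (rho : 'M[R[i]]_n) :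
  is_density rho -> \sum_i eigval rho i = 1.
Proof.
case=> herm _ tr1; apply: complexI; rewrite rmorph_sum /= -[RHS]tr1.
rewrite [in RHS](spectral_decomposition herm) -mulmxA mxtrace_mulC -mulmxA.
rewrite (unitarymxP (spectral_unitarymx rho)) mulmx1 mxtrace_diag.
by apply: eq_bigr => i _; rewrite spectral_eigval.
Qed.

Lemma eigval_01 (R : realType) (n : nat) (rho : 'M[R[i]]_n) (i : 'I_n) :
  is_density rho -> 0 <= eigval rho i <= 1.
Proof.
move=> dens; rewrite eigval_ge0//= -(sum_eigval dens) (bigD1 i)//= lerDl.
by apply: sumr_ge0 => j _; apply: eigval_ge0.
Qed.

(* The weights are the squared moduli of the entries of the unitary matrix
   taking an eigenbasis of [rho] to the rows of [V]. *)
Lemma unitary_diag_doubly_stochastic (R : realType) (n : nat)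
    (rho V : 'M[R[i]]_n) : rho \is hermsymmx -> V \is unitarymx ->
  exists w : 'I_n -> 'I_n -> R,
    [/\ forall i j, 0 <= w i j, forall i, \sum_j w i j = 1,
        forall j, \sum_i w i j = 1
      & forall i, (V *m rho *m V^t*) i i = (\sum_j w i j * eigval rho j)%:C].
Proof.
move=> herm unitV; set U := spectralmx rho.
have unitU : U \is unitarymx := spectral_unitarymx rho.
pose W := V *m U^t*.
have unitW : W \is unitarymx by rewrite mul_unitarymx ?trmxC_unitary.
pose w i j := complex.Re (`|W i j| ^+ 2).
have wE i j : (w i j)%:C = W i j * (W i j)^*%R.
  by rewrite -normCK RRe_real// rpredX// normr_real.
exists w; split=> [i j|i|j|i].
- by rewrite -ler0c wE mul_conjC_ge0.
- apply: complexI; rewrite rmorph_sum rmorph1.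
  have := unitarymxP unitW => /matrixP /(_ i i); rewrite !mxE eqxx; apply: etrans.
  by apply: eq_bigr => j _; rewrite [LHS]wE !mxE.
- apply: complexI; rewrite rmorph_sum rmorph1.
  have : W^t* \is unitarymx by rewrite trmxC_unitary.
  move=> /unitarymxP /matrixP /(_ j j); rewrite trmxCK !mxE eqxx; apply: etrans.
  by apply: eq_bigr => i _; rewrite [LHS]wE !mxE mulrC.
- have -> : V *m rho *m V^t* = W *m diag_mx (spectral_diag rho) *m W^t*.
    rewrite {1}(spectral_decomposition herm) /W trmx_mul map_mxM trmxCK.
    by rewrite !mulmxA.
  rewrite rmorph_sum mxE; apply: eq_bigr => j _.
  transitivity ((w i j)%:C * (eigval rho j)%:C); last by rewrite -rmorphM.
  rewrite wE -spectral_eigval// mul_mx_diag !mxE.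
  by rewrite mulrAC.
Qed.

Lemma is_density_convex (R : realType) (n : nat) (rho sigma : 'M[R[i]]_n)
    (t : R) : is_density rho -> is_density sigma -> 0 <= t <= 1 ->
  is_density (t%:C *: rho + (1 - t)%:C *: sigma).
Proof.
move=> [h1 p1 t1] [h2 p2 t2] /andP[t0 le_t1]; split.
- move: h1 h2 => /is_hermitianmxP e1 /is_hermitianmxP e2; apply/is_hermitianmxP.
  move: e1 e2; rewrite !expr0 !scale1r => e1 e2.
  rewrite linearD /= map_mxD !linearZ /= !map_mxZ -e1 -e2 /=.
  by rewrite !conj_Creal// complex_real.
- move=> v; rewrite mulmxDr mulmxDl -!scalemxAr -!scalemxAl.
  rewrite mxE [X in X + _]mxE [X in _ + X]mxE.
  by rewrite addr_ge0// mulr_ge0 ?p1 ?p2 ?ler0c ?subr_ge0.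
- by rewrite mxtraceD !mxtraceZ t1 t2 !mulr1 -rmorphD addrC subrK.
Qed.

Lemma trace_F_ln_convex (R : realType) (F : {poly R}) (n : nat) :
  (forall y, y <= 0 -> 0 <= (F^`()).[y] + (F^`(2)).[y]) ->
  convex_on_densities (@trace_F_ln R F n).
Proof.
move=> G0 rho sigma t dr ds t01; have [t0 t1] := andP t01.
set tau := _ + _; have dt : is_density tau by exact: is_density_convex.
have [hr _ _] := dr; have [hs _ _] := ds; have [ht _ _] := dt.
have unitV := spectral_unitarymx tau.
have [w [w0 w1 w2 wE]] := unitary_diag_doubly_stochastic hr unitV.
have [z [z0 z1 z2 zE]] := unitary_diag_doubly_stochastic hs unitV.
(* In an eigenbasis of [tau], the diagonals of [rho] and [sigma] are averages of their own
   eigenvalues. *)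
have tauE i : eigval tau i =
    t * (\sum_j w i j * eigval rho j) + (1 - t) * (\sum_j z i j * eigval sigma j).
  apply: complexI; rewrite -eigval_diag// rmorphD !rmorphM /= -wE -zE {2}/tau.
  rewrite mulmxDr mulmxDl -!scalemxAr -!scalemxAl.
  by rewrite mxE [X in X + _]mxE [X in _ + X]mxE.
have avg01 (u : 'I_n -> R) (a : 'I_n -> R) : (forall j, 0 <= u j) -> \sum_j u j = 1 ->
    (forall j, 0 <= a j <= 1) -> 0 <= \sum_j u j * a j <= 1.
  move=> u0 u1 a01; rewrite sumr_ge0 => [|j _]; last first.
    by case/andP: (a01 j) => ? _; rewrite mulr_ge0.
  by rewrite -u1 ler_sum// => j _; case/andP: (a01 j) => _ ?; rewrite ler_piMr.
have r01 j := eigval_01 j dr; have s01 j := eigval_01 j ds.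
have doubly (u : 'I_n -> 'I_n -> R) (a : 'I_n -> R) : (forall j, \sum_i u i j = 1) ->
    \sum_i \sum_j u i j * a j = \sum_j a j.
  move=> u2; rewrite exchange_big; apply: eq_bigr => j _.
  by rewrite -mulr_suml u2 mul1r.
rewrite /trace_F_ln !(sum_eigenvalues _ (fun l => l * F.[ln l])).
(* Unit column sums turn the traces of [rho] and [sigma] into double sums, so that the inequality
   can be proved for each eigenvalue of [tau]: first Jensen with weights t and 1 - t, then Jensen
   with the rows of weights. *)
rewrite -(doubly _ (fun j => eigval rho j * _) w2).
rewrite -(doubly _ (fun j => eigval sigma j * _) z2).
rewrite !mulr_sumr -big_split ler_sum// => i _ /=.
rewrite tauE (le_trans (jensen2_ln G0 t01 _ _)) ?avg01//.
by rewrite lerD// ler_wpM2l ?subr_ge0// jensen_ln.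
Qed.

End DensityMatrices.

(** * Karamata's inequality and majorization *)

(** Summation by parts as an induction: the partial sums of [d] are non-negative, so passing from
    [c m] to the smaller [c m.+1] in front of one only lowers the product. At the last index the
    full sum is 0. *)
Lemma abel_sum_ge0 (R : realType) (n : nat) (c d : nat -> R) :
  (forall i, (i.+1 < n)%N -> c i.+1 <= c i) ->
  (forall m, (m <= n)%N -> 0 <= \sum_(i < m) d i) -> \sum_(i < n) d i = 0 ->
  0 <= \sum_(i < n) c i * d i.
Proof.
case: n => [|n] c_le d_ge0 d0; first by rewrite big_ord0.
have partial m : (m < n.+1)%N ->
    c m * (\sum_(i < m.+1) d i) <= \sum_(i < m.+1) c i * d i.
  elim: m => [|m IH] lt_m; first by rewrite !big_ord1.
  rewrite big_ord_recr [leRHS]big_ord_recr /= mulrDr lerD2r.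
  apply: le_trans (IH (ltnW lt_m)).
  by rewrite ler_wpM2r ?c_le// d_ge0// ltnW.
by have := partial n (ltnSn n); rewrite d0 mulr0.
Qed.

Lemma horner_nondecreasing (R : realType) (p : {poly R}) :
  (forall y, y <= 0 -> 0 <= (p^`()).[y]) ->
  forall x y, x <= y -> y <= 0 -> p.[x] <= p.[y].
Proof.
move=> dp x y xy y0; have [->//|xny] := eqVneq x y.
have [c c_in eq_c] := MVT_between xny (is_derive_horner p).
rewrite -subr_ge0 eq_c mulr_ge0 ?subr_ge0// dp//.
move: c_in; rewrite (max_idPr xy) => /andP[_ cy].
exact: le_trans (ltW cy) y0.
Qed.

Lemma ln_lower_bound (R : realType) (s : seq R) :
  exists2 M : R, M <= 0 & {in s, forall x, M <= ln x}.
Proof.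
elim: s => [|a s [M M0 Ms]]; first by exists 0.
exists (Num.min M (ln a)); first by rewrite ge_min M0.
by move=> x; rewrite inE ge_min => /predU1P[->|/Ms->//]; rewrite lexx orbT.
Qed.

(* The subgradient of x F(ln x) may be -oo at 0; since only the finitely many
   points of [s] and [t] matter, any value below F(ln x) for all positive x
   among them serves instead. *)
Lemma karamata_ln (R : realType) (F : {poly R}) (n : nat) (s t : seq R) :
  (forall y, y <= 0 -> 0 <= (F^`()).[y] + (F^`(2)).[y]) ->
  size s = n -> size t = n -> {in s, forall x, 0 <= x <= 1} ->
  {in t, forall x, 0 <= x <= 1} -> sorted >=%R t ->
  (forall m, (1 <= m <= n)%N ->
     \sum_(l <- take m t) l <= \sum_(l <- take m s) l) ->
  \sum_(l <- s) l = \sum_(l <- t) l ->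
  \sum_(l <- t) l * F.[ln l] <= \sum_(l <- s) l * F.[ln l].
Proof.
move=> G0 ss st s01 t01 sorted_t maj eq_sum.
have dF0 := deriv_ge0_of_extremal_ge0 G0.
have [M M0 Mle] := ln_lower_bound (s ++ t).
have sub_s x : x \in s -> M <= ln x by move=> xs; rewrite Mle// mem_cat xs.
have sub_t x : x \in t -> M <= ln x by move=> xt; rewrite Mle// mem_cat xt orbT.
pose g x := if x == 0 then F.[M] else (F + F^`()).[ln x].
have subgrad x y : x \in t -> y \in s ->
    x * F.[ln x] + g x * (y - x) <= y * F.[ln y].
  move=> xt ys; have /andP[x0 x1] := t01 x xt; have y01 := s01 y ys.
  rewrite /g; have [->|xn0] := eqVneq x 0; last first.
    by apply: ln_subgradient => //; rewrite lt_neqAle eq_sym xn0 x0.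
  rewrite mul0r add0r subr0 mulrC; case/andP: y01 => y0 y1.
  by rewrite ler_wpM2l// (horner_nondecreasing dF0)// ?sub_s ?ln_le0.
(* For x > 0 this holds because (F + F')' = G >= 0; for x = 0 < y because F(M) <= F(ln y) and F'(ln
   y) >= 0. *)
have g_le x y : x \in t -> y \in t -> x <= y -> g x <= g y.
  move=> xt yt xy; have /andP[x0 x1] := t01 x xt; have /andP[y0 y1] := t01 y yt.
  rewrite /g; have [y_0|yn0] := eqVneq y 0.
    by rewrite (_ : x == 0)//; rewrite eq_le x0 andbT -y_0.
  have [x_0|xn0] := eqVneq x 0.
    rewrite hornerD -[leLHS]addr0 lerD ?dF0 ?ln_le0//.
    by rewrite (horner_nondecreasing dF0)// ?sub_t ?ln_le0.
  apply: horner_nondecreasing (ln_le0 y1) => [z z0|].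
    by rewrite derivD hornerD G0.
  by rewrite ler_ln// posrE lt_neqAle eq_sym ?xn0 ?yn0.
have sum_take (u : seq R) m : (m <= size u)%N ->
    \sum_(l <- take m u) l = \sum_(i < m) u`_i.
  move=> le_m; rewrite (big_nth 0) size_takel// big_mkord.
  by apply: eq_bigr => i _; rewrite nth_take.
have sum_nth (u : seq R) (f : R -> R) : size u = n ->
    \sum_(l <- u) f l = \sum_(i < n) f u`_i.
  by move=> su; rewrite (big_nth 0) su big_mkord.
(* Majorization makes the partial sums of the differences non-negative, equality of the totals makes
   the full sum 0, and [g] decreases along the sorted list [t]. *)
have abel := @abel_sum_ge0 R n (fun i => g t`_i) (fun i => s`_i - t`_i).
rewrite !(sum_nth _ (fun l => l * F.[ln l]))// -subr_ge0 -sumrB.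
apply: le_trans (abel _ _ _) _.
- move=> i lt_i; apply: g_le; rewrite ?mem_nth ?st// ?(ltnW lt_i)//.
  by have /(sortedP 0) := sorted_t; apply; rewrite st.
- move=> [|m] le_m; first by rewrite big_ord0.
  by rewrite sumrB -!sum_take ?ss ?st// subr_ge0 maj.
- by rewrite sumrB -!(sum_nth _ id)// eq_sum subrr.
- apply: ler_sum => i _; rewrite lerBrDl subgrad// mem_nth ?ss ?st//.
Qed.

Lemma eigenvalues_01 (R : realType) (n : nat) (rho : 'M[R[i]%C]_n) :
  is_density rho -> {in eigenvalues rho, forall x, 0 <= x <= 1}.
Proof.
move=> dens x; rewrite (perm_mem (perm_eigenvalues rho)) => /mapP[i _ ->].
exact: eigval_01.
Qed.

Lemma size_eigenvalues (R : realType) (n : nat) (rho : 'M[R[i]%C]_n) :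
  size (eigenvalues rho) = n.
Proof. by rewrite size_sort size_map size_enum_ord. Qed.

Lemma sum_eigenvalues_density (R : realType) (n : nat) (rho : 'M[R[i]%C]_n) :
  is_density rho -> \sum_(l <- eigenvalues rho) l = 1.
Proof. by move=> dens; rewrite (sum_eigenvalues rho id) sum_eigval. Qed.

Lemma trace_F_ln_schur_convex (R : realType) (F : {poly R}) (n : nat)
    (rho sigma : 'M[R[i]%C]_n) :
  (forall y, y <= 0 -> 0 <= (F^`()).[y] + (F^`(2)).[y]) ->
  is_density rho -> is_density sigma -> majorizes rho sigma ->
  trace_F_ln F sigma <= trace_F_ln F rho.
Proof.
move=> G0 dr ds maj; apply: (@karamata_ln _ _ n) => //.
- exact: size_eigenvalues.
- exact: size_eigenvalues.
- exact: eigenvalues_01.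
- exact: eigenvalues_01.
- by apply: sort_sorted => x y; apply: le_total.
- by rewrite !sum_eigenvalues_density.
Qed.

(** * Extremal monotones and the final assembly *)

Lemma extremal_F_ge0 (R : realType) (F : {poly R}) : extremal_F F ->
  forall y, y <= 0 -> 0 <= (F^`()).[y] + (F^`(2)).[y].
Proof.
move=> [G [a _ GE] [FG _]] y y0; rewrite addrC -hornerD FG.
have sqr_prod : 0 <= (\prod_(x <- a) ('X + x%:P) ^+ 2).[y].
  rewrite horner_prod; apply: prodr_ge0 => x _.
  by rewrite horner_exp sqr_ge0.
case: GE => -> //; rewrite hornerM mulr_ge0// hornerN hornerX oppr_ge0 //.
Qed.

Lemma trace_F_ln_sum (R : realType) (C : R) (s : seq (R * {poly R})) (n : nat)
    (rho : 'M[R[i]%C]_n) : is_density rho ->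
  trace_F_ln (C%:P + \sum_(x <- s) x.1 *: x.2) rho
    = C + \sum_(x <- s) x.1 * trace_F_ln x.2 rho.
Proof.
move=> dens; rewrite /trace_F_ln.
under eq_bigr do rewrite hornerD hornerC mulrDr horner_sum.
rewrite big_split /= -mulr_suml sum_eigenvalues_density// mul1r; congr (_ + _).
under eq_bigr do rewrite mulr_sumr.
rewrite exchange_big; apply: eq_bigr => x _; rewrite mulr_sumr.
by apply: eq_bigr => l _; rewrite hornerZ mulrCA.
Qed.

Theorem mainTheorem4 (R : realType) :
  (forall F : {poly R}, extremal_F F ->
     forall n : nat,
       convex_on_densities (@trace_F_ln R F n) /\
       (forall rho sigma : 'M[R[i]%C]_n,
          is_density rho -> is_density sigma -> majorizes rho sigma ->
          trace_F_ln F sigma <= trace_F_ln F rho)) /\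
  (forall F : {poly R},
     ((forall y : R, y <= 0 -> 0 <= (F^`()).[y] + (F^`(2)).[y]) <->
      convex_function (`]0, 1]%classic : set R) (fun x : R => x * F.[ln x])) /\
     ((forall y : R, y <= 0 -> 0 <= (F^`()).[y] + (F^`(2)).[y]) ->
      exists (k : nat) (c : 'I_k -> R) (E : 'I_k -> {poly R}) (C : R),
        [/\ forall j, 0 <= c j,
            forall j, extremal_F (E j)
          & forall (n : nat) (rho : 'M[R[i]%C]_n), is_density rho ->
              trace_F_ln F rho
                = C + \sum_(j < k) c j * trace_F_ln (E j) rho])).
Proof.
split=> [F eF n|F].
  have G0 := extremal_F_ge0 eF; split; first exact: trace_F_ln_convex.
  by move=> rho sigma; apply: trace_F_ln_schur_convex.
split=> [|G0]; first exact: convex_xFlnP.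
have [s s0 FE] := extremal_decomposition G0.
(* The list of pairs becomes two families over ['I_k]; the default pair is never reached. *)
exists (size s), (fun j => (nth (0, 0) s j).1), (fun j => (nth (0, 0) s j).2), F.[0].
split=> [j|j|n rho dens].
- by case: (s0 _ (mem_nth (0, 0) (ltn_ord j))).
- by case: (s0 _ (mem_nth (0, 0) (ltn_ord j))).
- by rewrite {1}FE trace_F_ln_sum// (big_nth (0, 0)) big_mkord.
Qed.
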